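(* Let $D=(F,R,>)$ be a defeasible theory (without fail-expressions) and let $\alpha$ be an annotation function for $D$. Let $d\in\{\delta^*,\delta,\partial^*,\partial\}$. Suppose that every annotation used by $\alpha$ in $\alpha(R)$ is either $\mathtt{free}$ or $d$, and that there is no fail-expression in $R$. Then for every literal $q$: (i) $\mathcal{M}(\alpha(D))\models_K \mathtt{defeasibly}_d(d\;q)$ iff $\mathcal{M}_d(D)\models_K \mathtt{defeasibly}(q)$; (ii) $\mathcal{M}(\alpha(D))\models_K \neg\mathtt{defeasibly}_d(d\;q)$ iff $\mathcal{M}_d(D)\models_K \neg\mathtt{defeasibly}(q)$. Furthermore, if $d\in\{\delta^*,\delta\}$, then for every literal $q$: (iii) $\mathcal{M}(\alpha(D))\models_K \mathtt{supported}_d(d\;q)$ iff $\mathcal{M}_d(D)\models_K \mathtt{supported}(q)$; (iv) $\mathcal{M}(\alpha(D))\models_K \neg\mathtt{supported}_d(d\;q)$ iff $\mathcal{M}_d(D)\models_K \neg\mathtt{supported}(q)$.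
   Context: Defeasible theories. Fix a set $\Sigma$ of literals closed under negation; the complement ${\sim}q$ of an atom $p$ is $\neg p$ and of $\neg p$ is $p$. A defeasible theory is $D=(F,R,>)$: $F$ a set of literals (facts), $R$ a finite set of rules each with a distinct label, and $>$ an acyclic binary relation on labels (superiority). A rule $r: L_1,\dots,L_n \to p$ is strict, $r: L_1,\dots,L_n\Rightarrow p$ is defeasible, $r: L_1,\dots,L_n\leadsto p$ is a defeater ($p$ the head, $L_i$ the body). Annotated theories. Tags are the proof tags $\partial,\delta,\partial^*,\delta^*$ and the extra tag $\mathtt{free}$. An annotated literal is $t\,q$ with $t$ a tag and $q$ a literal; a fail-expression is $\mathtt{fail}\,L$ with $L$ an annotated literal. An annotated defeasible theory is a defeasible theory whose defeasible rules and defeaters have bodies consisting of annotated literals and fail-expressions (strict rules are not annotated). An annotation function $\alpha$ for a theory $D$ maps each occurrence of a literal in the body of a defeasible rule or defeater to a tag; $\alpha(D)$ is the resulting annotated theory. Representation of a theory as logic-program facts: $\mathtt{fact}(p)$ for $p\in F$; $\mathtt{strict}(r,p,[L_1,\dots,L_n])$, $\mathtt{defeasible}(r,p,[L_1,\dots,L_n])$, $\mathtt{defeater}(r,p,[L_1,\dots,L_n])$ for each rule $r$ of the respective type; $\mathtt{sup}(r_i,r_j)$ whenever $r_i>r_j$. Common clauses: $\mathtt{supportive\_rule}(L,H,B)$ :- $\mathtt{strict}(L,H,B)$; $\mathtt{supportive\_rule}(L,H,B)$ :- $\mathtt{defeasible}(L,H,B)$; $\mathtt{rule}(L,H,B)$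 :- $\mathtt{supportive\_rule}(L,H,B)$; $\mathtt{rule}(L,H,B)$ :- $\mathtt{defeater}(L,H,B)$; $\mathtt{definitely}(X)$ :- $\mathtt{fact}(X)$; $\mathtt{definitely}(X)$ :- $\mathtt{strict}(R,X,[Y_1..Y_n])$, $\mathtt{definitely}(Y_1),\dots,\mathtt{definitely}(Y_n)$. The annotated meta-program $\mathcal{M}(D)$ (for annotated $D$) consists of the representation of $D$, the common clauses, the facts $\mathtt{team}(\partial),\mathtt{team}(\delta),\mathtt{indiv}(\partial^* ),\mathtt{indiv}(\delta^* )$, $\mathtt{ambiguity\_blocking}(\partial),\mathtt{ambiguity\_blocking}(\partial^* )$, $\mathtt{ambiguity\_propagating}(\delta),\mathtt{ambiguity\_propagating}(\delta^* )$, $\mathtt{proof\_tag}(t)$ for $t\in\{\partial,\delta,\partial^*,\delta^*\}$, and the following clauses, where a subscript $Z$ is an argument and every clause whose head has subscript $Z$ implicitly contains $\mathtt{proof\_tag}(Z)$ in its body, and $\mathtt{not}$ is negation as failure: $\mathtt{defeasibly}_Z(\mathtt{free}\,X)$ :- $\mathtt{defeasibly}_Z(Z\,X)$. $\mathtt{defeasibly}_Z(\mathtt{fail}\,X)$ :- $\mathtt{not}\ \mathtt{defeasibly}_Z(X)$. $\mathtt{defeasibly}_Z(X)$ :- $\mathtt{definitely}(X)$. $\mathtt{defeasibly}_Z(Y\,X)$ :- $\mathtt{proof\_tag}(Y)$, $\mathtt{not}\ \mathtt{definitely}({\sim}X)$, $\mathtt{supportive\_rule}(R,X,[W_1..W_n])$,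 $\mathtt{defeasibly}_Y(W_1),\dots,\mathtt{defeasibly}_Y(W_n)$, $\mathtt{not}\ \mathtt{overruled}_Y(R,X)$. $\mathtt{overruled}_Z(R,X)$ :- $\mathtt{ambiguity\_blocking}(Z)$, $\mathtt{rule}(S,{\sim}X,[U_1..U_n])$, $\mathtt{defeasibly}_Z(U_1),\dots,\mathtt{defeasibly}_Z(U_n)$, $\mathtt{not}\ \mathtt{defeated}_Z(R,S,{\sim}X)$. $\mathtt{overruled}_Z(R,X)$ :- $\mathtt{ambiguity\_propagating}(Z)$, $\mathtt{rule}(S,{\sim}X,[U_1..U_n])$, $\mathtt{supported}_Z(U_1),\dots,\mathtt{supported}_Z(U_n)$, $\mathtt{not}\ \mathtt{defeated}_Z(R,S,{\sim}X)$. $\mathtt{defeated}_Z(R,S,{\sim}X)$ :- $\mathtt{team}(Z)$, $\mathtt{sup}(T,S)$, $\mathtt{supportive\_rule}(T,X,[V_1..V_n])$, $\mathtt{defeasibly}_Z(V_1),\dots,\mathtt{defeasibly}_Z(V_n)$. $\mathtt{defeated}_Z(R,S,{\sim}X)$ :- $\mathtt{indiv}(Z)$, $\mathtt{sup}(R,S)$. $\mathtt{supported}_Z(\mathtt{free}\,X)$ :- $\mathtt{supported}_Z(Z\,X)$. $\mathtt{supported}_Z(\mathtt{fail}\,X)$ :- $\mathtt{not}\ \mathtt{supported}_Z(X)$. $\mathtt{supported}_Z(X)$ :- $\mathtt{definitely}(X)$. $\mathtt{supported}_Z(Y\,X)$ :- $\mathtt{proof\_tag}(Y)$, $\mathtt{supportive\_rule}(R,X,[W_1..W_n])$,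 $\mathtt{supported}_Y(W_1),\dots,\mathtt{supported}_Y(W_n)$, $\mathtt{not}\ \mathtt{beaten}_Y(R,X)$. $\mathtt{beaten}_Z(R,X)$ :- $\mathtt{rule}(S,{\sim}X,[W_1..W_n])$, $\mathtt{defeasibly}_Z(W_1),\dots,\mathtt{defeasibly}_Z(W_n)$, $\mathtt{sup}(S,R)$. The original meta-programs $\mathcal{M}_d(D)$ (for an unannotated theory $D$) consist of the representation of $D$, the common clauses, and clauses selected from: (A) $\mathtt{defeasibly}(X)$ :- $\mathtt{definitely}(X)$. (B) $\mathtt{defeasibly}(X)$ :- $\mathtt{not}\ \mathtt{definitely}({\sim}X)$, $\mathtt{supportive\_rule}(R,X,[Y_1..Y_n])$, $\mathtt{defeasibly}(Y_1),\dots,\mathtt{defeasibly}(Y_n)$, $\mathtt{not}\ \mathtt{overruled}(R,X)$. (C) $\mathtt{overruled}(R,X)$ :- $\mathtt{rule}(S,{\sim}X,[U_1..U_n])$, $\mathtt{defeasibly}(U_1),\dots,\mathtt{defeasibly}(U_n)$, $\mathtt{not}\ \mathtt{defeated}(S,{\sim}X)$. (D) $\mathtt{defeated}(S,{\sim}X)$ :- $\mathtt{sup}(T,S)$, $\mathtt{supportive\_rule}(T,X,[V_1..V_n])$, $\mathtt{defeasibly}(V_1),\dots,\mathtt{defeasibly}(V_n)$. (E) $\mathtt{supported}(X)$ :- $\mathtt{definitely}(X)$. (F) $\mathtt{supported}(X)$ :- $\mathtt{supportive\_rule}(R,X,[Y_1..Y_n])$, $\mathtt{supported}(Y_1),\dots,\mathtt{supported}(Y_n)$,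 $\mathtt{not}\ \mathtt{beaten}(R,X)$. (G) $\mathtt{beaten}(R,X)$ :- $\mathtt{rule}(S,{\sim}X,[W_1..W_n])$, $\mathtt{defeasibly}(W_1),\dots,\mathtt{defeasibly}(W_n)$, $\mathtt{sup}(S,R)$. (H) $\mathtt{overruled}(R,X)$ :- $\mathtt{rule}(S,{\sim}X,[U_1..U_n])$, $\mathtt{supported}(U_1),\dots,\mathtt{supported}(U_n)$, $\mathtt{not}\ \mathtt{defeated}(S,{\sim}X)$. (I) $\mathtt{overruled}(R,X)$ :- $\mathtt{rule}(S,{\sim}X,[U_1..U_n])$, $\mathtt{defeasibly}(U_1),\dots,\mathtt{defeasibly}(U_n)$, $\mathtt{not}\ \mathtt{sup}(R,S)$. (J) $\mathtt{overruled}(R,X)$ :- $\mathtt{rule}(S,{\sim}X,[U_1..U_n])$, $\mathtt{supported}(U_1),\dots,\mathtt{supported}(U_n)$, $\mathtt{not}\ \mathtt{sup}(R,S)$. $\mathcal{M}_\partial$ uses (A)–(D); $\mathcal{M}_\delta$ uses (A),(B),(H),(D),(E),(F),(G); $\mathcal{M}_{\partial^*}$ uses (A),(B),(I); $\mathcal{M}_{\delta^*}$ uses (A),(B),(J),(E),(F),(G). $\models_K$ denotes consequence under Kunen's semantics: the 3-valued logical consequences of the Clark completion of the program, equivalently the atoms true (resp. false, for $\neg A$) in $\Phi\uparrow n$ for some finite $n$, where $\Phi$ is Fitting's 3-valued immediate-consequence operator.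
   Formalization: In M(α(D)), the clauses defeasibly_Z(X) and supported_Z(X) :- definitely(X) are read with X carrying any annotation, which definitely ignores, and unannotated strict-rule bodies used in supportive rules are read as annotated free; taken literally the claim fails, e.g. for D=({q},∅,∅). *)

(* Defs.v *)
From Stdlib Require Import List Relations.
Import ListNotations.
Set Implicit Arguments.
Unset Strict Implicit.
Unset Printing Implicit Defensive.

(* ------------------------------------------------------------------------ *)
(* Ground normal logic programs and Kunen's semantics                       *)
(* ------------------------------------------------------------------------ *)

(* [Neg a] is negation as failure in a clause body, and the query "not a" on
   the right of [kunen]. *)
Inductive plit (At : Type) : Type :=
| Pos (a : At)
| Neg (a : At).

Record clause (At : Type) : Type := Clause
  { clause_head : At;
    clause_body : list (plit At) }.

Notation "h :- b" := (Clause h b) (at level 80, no associativity).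

(* A program is given by the (possibly infinite) set of all ground instances
   of its clauses. *)
Definition program (At : Type) : Type := clause At -> Prop.

(* Partial (3-valued) interpretations; an atom in neither component is
   undefined. *)
Record interp (At : Type) : Type := Interp
  { true_in : At -> Prop;
    false_in : At -> Prop }.

Definition undefined {At : Type} : interp At :=
  Interp (fun _ => False) (fun _ => False).

Definition lit_true {At : Type} (I : interp At) (l : plit At) : Prop :=
  match l with Pos a => true_in I a | Neg a => false_in I a end.

Definition lit_false {At : Type} (I : interp At) (l : plit At) : Prop :=
  match l with Pos a => false_in I a | Neg a => true_in I a end.

Definition fitting {At : Type} (P : program At) (I : interp At) : interp At :=
  Interp
    (fun a => exists c, P c /\ clause_head c = a
                        /\ Forall (lit_true I) (clause_body c))
    (fun a => forall c, P c -> clause_head c = a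
                        -> Exists (lit_false I) (clause_body c)).

Definition fitting_up {At : Type} (P : program At) (n : nat) : interp At :=
  Nat.iter n (fitting P) undefined.

(* The iteration stops at finite stages: Kunen's semantics is not the least
   fixpoint of [fitting]. *)
Definition kunen {At : Type} (P : program At) (l : plit At) : Prop :=
  exists n, lit_true (fitting_up P n) l.

Definition lift_plit {At At' : Type} (f : At -> At') (l : plit At) : plit At' :=
  match l with Pos a => Pos (f a) | Neg a => Neg (f a) end.

Definition lift_clause {At At' : Type} (f : At -> At') (c : clause At)
  : clause At' :=
  f (clause_head c) :- map (lift_plit f) (clause_body c).

(* ------------------------------------------------------------------------ *)
(* Defeasible theories                                                      *)
(* ------------------------------------------------------------------------ *)

(* A set of literals closed under negation is the set of literals over a type
   of atoms. *)
Inductive literal (A : Type) : Type :=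
| PosL (p : A)
| NegL (p : A).

Definition compl {A : Type} (q : literal A) : literal A :=
  match q with PosL p => NegL p | NegL p => PosL p end.

(* [B] is the type of body elements of defeasible rules and defeaters:
   [literal A] in a plain theory, [aexpr A] in an annotated one.  Bodies of
   strict rules are never annotated. *)
Inductive rule (A L B : Type) : Type :=
| Strict     (r : L) (p : literal A) (body : list (literal A))
| Defeasible (r : L) (p : literal A) (body : list B)
| Defeater   (r : L) (p : literal A) (body : list B).
Arguments Strict {A L B} r p body.
Arguments Defeasible {A L B} r p body.
Arguments Defeater {A L B} r p body.

Definition label {A L B : Type} (ru : rule A L B) : L :=
  match ru with
  | Strict r _ _ | Defeasible r _ _ | Defeater r _ _ => r
  end.

Record theory (A L B : Type) : Type := Theory
  { facts : literal A -> Prop;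
    rules : list (rule A L B);
    superior : L -> L -> Prop;
    distinct_labels : NoDup (map label rules);
    superior_acyclic : forall r, ~ clos_trans L superior r r }.

(* Body elements are literals, so these theories contain no fail-expression. *)
Definition defeasible_theory (A L : Type) : Type := theory A L (literal A).

(* ------------------------------------------------------------------------ *)
(* Annotated theories                                                       *)
(* ------------------------------------------------------------------------ *)

Inductive ptag : Type := partial | delta | partial_star | delta_star.

Inductive tag : Type :=
| Proof_tag (d : ptag)
| free.

Inductive aexpr (A : Type) : Type :=
| Ann  (t : tag) (q : literal A)
| Fail (t : tag) (q : literal A).

Definition annotated_theory (A L : Type) : Type := theory A L (aexpr A).

(* Labels being distinct, an occurrence of a literal in a body is determined
   by the label of the rule and the position in the body (from 0); the values
   at other arguments play no role. *)
Definition annotation (L : Type) : Type := L -> nat -> tag.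

Fixpoint annotate_body {A : Type} (f : nat -> tag) (b : list (literal A))
  : list (aexpr A) :=
  match b with
  | [] => []
  | q :: b' => Ann (f 0) q :: annotate_body (fun i => f (S i)) b'
  end.

Definition annotate_rule {A L : Type} (alpha : annotation L)
  (ru : rule A L (literal A)) : rule A L (aexpr A) :=
  match ru with
  | Strict r p b => Strict r p b
  | Defeasible r p b => Defeasible r p (annotate_body (alpha r) b)
  | Defeater r p b => Defeater r p (annotate_body (alpha r) b)
  end.

Lemma annotate_distinct_labels {A L : Type} (alpha : annotation L)
  (R : list (rule A L (literal A))) :
  NoDup (map label R) -> NoDup (map label (map (annotate_rule alpha) R)).
Proof.
  rewrite map_map. intros H.
  rewrite (map_ext _ label); [exact H | now intros []].
Qed.

Definition annotate {A L : Type} (alpha : annotation L)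
  (D : defeasible_theory A L) : annotated_theory A L :=
  {| facts := facts D;
     rules := map (annotate_rule alpha) (rules D);
     superior := superior D;
     distinct_labels := annotate_distinct_labels alpha (distinct_labels D);
     superior_acyclic := @superior_acyclic _ _ _ D |}.

Definition annotated_body {A L : Type} (ru : rule A L (aexpr A))
  : list (aexpr A) :=
  match ru with
  | Strict _ _ _ => []
  | Defeasible _ _ b | Defeater _ _ b => b
  end.

Definition annotation_used {A L : Type} (D : annotated_theory A L) (t : tag)
  : Prop :=
  exists ru q, In ru (rules D)
    /\ (In (Ann t q) (annotated_body ru) \/ In (Fail t q) (annotated_body ru)).

(* ------------------------------------------------------------------------ *)
(* Representation of a theory and common clauses                            *)
(* ------------------------------------------------------------------------ *)

Inductive common_atom (A L B : Type) : Type :=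
| fact_ (p : literal A)
| strict_ (r : L) (p : literal A) (b : list (literal A))
| defeasible_ (r : L) (p : literal A) (b : list B)
| defeater_ (r : L) (p : literal A) (b : list B)
| sup_ (r s : L)
| supportive_rule_ (r : L) (p : literal A) (b : list B)
| rule_ (r : L) (p : literal A) (b : list B)
| definitely_ (p : literal A).
Arguments fact_ {A L B} p.
Arguments strict_ {A L B} r p b.
Arguments defeasible_ {A L B} r p b.
Arguments defeater_ {A L B} r p b.
Arguments sup_ {A L B} r s.
Arguments supportive_rule_ {A L B} r p b.
Arguments rule_ {A L B} r p b.
Arguments definitely_ {A L B} p.

(* [bare] turns an unannotated literal in the body of a strict rule into a
   body element when the rule is used as a supportive rule. *)
Inductive common_program {A L B : Type} (bare : literal A -> B)
  (D : theory A L B) : program (common_atom A L B) :=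
| rep_fact p :
    facts D p -> common_program bare D (fact_ p :- [])
| rep_strict r p b :
    In (Strict r p b) (rules D) -> common_program bare D (strict_ r p b :- [])
| rep_defeasible r p b :
    In (Defeasible r p b) (rules D) ->
    common_program bare D (defeasible_ r p b :- [])
| rep_defeater r p b :
    In (Defeater r p b) (rules D) ->
    common_program bare D (defeater_ r p b :- [])
| rep_sup r s :
    superior D r s -> common_program bare D (sup_ r s :- [])
| common_supportive_strict r p b :
    common_program bare D
      (supportive_rule_ r p (map bare b) :- [Pos (strict_ r p b)])
| common_supportive_defeasible r p b :
    common_program bare D
      (supportive_rule_ r p b :- [Pos (defeasible_ r p b)])
| common_rule_supportive r p b :
    common_program bare D (rule_ r p b :- [Pos (supportive_rule_ r p b)])
| common_rule_defeater r p b :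
    common_program bare D (rule_ r p b :- [Pos (defeater_ r p b)])
| common_definitely_fact x :
    common_program bare D (definitely_ x :- [Pos (fact_ x)])
| common_definitely_strict r x ys :
    common_program bare D
      (definitely_ x :-
         Pos (strict_ r x ys) :: map (fun y => Pos (definitely_ y)) ys).

(* ------------------------------------------------------------------------ *)
(* The original meta-programs M_d                                           *)
(* ------------------------------------------------------------------------ *)

Inductive orig_atom (A L : Type) : Type :=
| OCommon (a : common_atom A L (literal A))
| ODefeasibly (x : literal A)
| OOverruled (r : L) (x : literal A)
| ODefeated (s : L) (x : literal A)
| OSupported (x : literal A)
| OBeaten (r : L) (x : literal A).
Arguments OCommon {A L} a.
Arguments ODefeasibly {A L} x.
Arguments OOverruled {A L} r x.
Arguments ODefeated {A L} s x.
Arguments OSupported {A L} x.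
Arguments OBeaten {A L} r x.

Inductive clause_name : Type := cA | cB | cC | cD | cE | cF | cG | cH | cI | cJ.

Inductive orig_clause {A L : Type} : clause_name -> program (orig_atom A L) :=
| orig_A x :
    orig_clause cA (ODefeasibly x :- [Pos (OCommon (definitely_ x))])
| orig_B r x ys :
    orig_clause cB
      (ODefeasibly x :-
         [Neg (OCommon (definitely_ (compl x)));
          Pos (OCommon (supportive_rule_ r x ys))]
         ++ map (fun y => Pos (ODefeasibly y)) ys
         ++ [Neg (OOverruled r x)])
| orig_C r x s us :
    orig_clause cC
      (OOverruled r x :-
         [Pos (OCommon (rule_ s (compl x) us))]
         ++ map (fun u => Pos (ODefeasibly u)) us
         ++ [Neg (ODefeated s (compl x))])
| orig_D s x t vs :
    orig_clause cD
      (ODefeated s (compl x) :-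
         [Pos (OCommon (sup_ t s));
          Pos (OCommon (supportive_rule_ t x vs))]
         ++ map (fun v => Pos (ODefeasibly v)) vs)
| orig_E x :
    orig_clause cE (OSupported x :- [Pos (OCommon (definitely_ x))])
| orig_F r x ys :
    orig_clause cF
      (OSupported x :-
         [Pos (OCommon (supportive_rule_ r x ys))]
         ++ map (fun y => Pos (OSupported y)) ys
         ++ [Neg (OBeaten r x)])
| orig_G r x s ws :
    orig_clause cG
      (OBeaten r x :-
         [Pos (OCommon (rule_ s (compl x) ws))]
         ++ map (fun w => Pos (ODefeasibly w)) ws
         ++ [Pos (OCommon (sup_ s r))])
| orig_H r x s us :
    orig_clause cH
      (OOverruled r x :-
         [Pos (OCommon (rule_ s (compl x) us))]
         ++ map (fun u => Pos (OSupported u)) us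
         ++ [Neg (ODefeated s (compl x))])
| orig_I r x s us :
    orig_clause cI
      (OOverruled r x :-
         [Pos (OCommon (rule_ s (compl x) us))]
         ++ map (fun u => Pos (ODefeasibly u)) us
         ++ [Neg (OCommon (sup_ r s))])
| orig_J r x s us :
    orig_clause cJ
      (OOverruled r x :-
         [Pos (OCommon (rule_ s (compl x) us))]
         ++ map (fun u => Pos (OSupported u)) us
         ++ [Neg (OCommon (sup_ r s))]).

Definition selected (d : ptag) : list clause_name :=
  match d with
  | partial => [cA; cB; cC; cD]
  | delta => [cA; cB; cH; cD; cE; cF; cG]
  | partial_star => [cA; cB; cI]
  | delta_star => [cA; cB; cJ; cE; cF; cG]
  end.

Inductive orig_program {A L : Type} (d : ptag) (D : defeasible_theory A L)
  : program (orig_atom A L) :=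
| orig_common c :
    common_program (fun q => q) D c -> orig_program d D (lift_clause OCommon c)
| orig_selected k c :
    In k (selected d) -> orig_clause k c -> orig_program d D c.

(* ------------------------------------------------------------------------ *)
(* The annotated meta-program M                                             *)
(* ------------------------------------------------------------------------ *)

(* In every predicate with a subscript Z, the first argument is Z. *)
Inductive ann_atom (A L : Type) : Type :=
| Common (a : common_atom A L (aexpr A))
| Team (z : tag)
| Indiv (z : tag)
| Ambiguity_blocking (z : tag)
| Ambiguity_propagating (z : tag)
| Is_proof_tag (z : tag)
| Defeasibly (z : tag) (w : aexpr A)
| Overruled (z : tag) (r : L) (x : literal A)
| Defeated (z : tag) (r s : L) (x : literal A)
| Supported (z : tag) (w : aexpr A)
| Beaten (z : tag) (r : L) (x : literal A).
Arguments Common {A L} a.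
Arguments Team {A L} z.
Arguments Indiv {A L} z.
Arguments Ambiguity_blocking {A L} z.
Arguments Ambiguity_propagating {A L} z.
Arguments Is_proof_tag {A L} z.
Arguments Defeasibly {A L} z w.
Arguments Overruled {A L} z r x.
Arguments Defeated {A L} z r s x.
Arguments Supported {A L} z w.
Arguments Beaten {A L} z r x.

(* Two conventions relate annotated and unannotated literals.
   - An unannotated body literal of a strict rule, when the rule is used as a
     supportive rule, is read as annotated with [free] ([ann_common]).
   - In "defeasibly_Z(X) :- definitely(X)" and "supported_Z(X) :-
     definitely(X)", X is a literal carrying any annotation, which definitely
     ignores ([ann_defeasibly_definitely], [ann_supported_definitely]).
   Were X restricted to unannotated literals, a fact q would not yield
   defeasibly_d(d q), and a strict rule would never support a conclusion from
   a merely defeasible premise. *)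
Inductive ann_program {A L : Type} (D : annotated_theory A L)
  : program (ann_atom A L) :=
| ann_common c :
    common_program (Ann free) D c -> ann_program D (lift_clause Common c)
| ann_team_partial : ann_program D (Team (Proof_tag partial) :- [])
| ann_team_delta : ann_program D (Team (Proof_tag delta) :- [])
| ann_indiv_partial_star : ann_program D (Indiv (Proof_tag partial_star) :- [])
| ann_indiv_delta_star : ann_program D (Indiv (Proof_tag delta_star) :- [])
| ann_blocking_partial :
    ann_program D (Ambiguity_blocking (Proof_tag partial) :- [])
| ann_blocking_partial_star :
    ann_program D (Ambiguity_blocking (Proof_tag partial_star) :- [])
| ann_propagating_delta :
    ann_program D (Ambiguity_propagating (Proof_tag delta) :- [])
| ann_propagating_delta_star :
    ann_program D (Ambiguity_propagating (Proof_tag delta_star) :- [])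
| ann_proof_tag t : ann_program D (Is_proof_tag (Proof_tag t) :- [])
| ann_defeasibly_free z x :
    ann_program D
      (Defeasibly z (Ann free x) :-
         [Pos (Is_proof_tag z); Pos (Defeasibly z (Ann z x))])
| ann_defeasibly_fail z t x :
    ann_program D
      (Defeasibly z (Fail t x) :-
         [Pos (Is_proof_tag z); Neg (Defeasibly z (Ann t x))])
| ann_defeasibly_definitely z t x :
    ann_program D
      (Defeasibly z (Ann t x) :-
         [Pos (Is_proof_tag z); Pos (Common (definitely_ x))])
| ann_defeasibly_rule z y r x ws :
    ann_program D
      (Defeasibly z (Ann y x) :-
         [Pos (Is_proof_tag z);
          Pos (Is_proof_tag y);
          Neg (Common (definitely_ (compl x)));
          Pos (Common (supportive_rule_ r x ws))]
         ++ map (fun w => Pos (Defeasibly y w)) ws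
         ++ [Neg (Overruled y r x)])
| ann_overruled_blocking z r x s us :
    ann_program D
      (Overruled z r x :-
         [Pos (Is_proof_tag z);
          Pos (Ambiguity_blocking z);
          Pos (Common (rule_ s (compl x) us))]
         ++ map (fun u => Pos (Defeasibly z u)) us
         ++ [Neg (Defeated z r s (compl x))])
| ann_overruled_propagating z r x s us :
    ann_program D
      (Overruled z r x :-
         [Pos (Is_proof_tag z);
          Pos (Ambiguity_propagating z);
          Pos (Common (rule_ s (compl x) us))]
         ++ map (fun u => Pos (Supported z u)) us
         ++ [Neg (Defeated z r s (compl x))])
| ann_defeated_team z r s x t vs :
    ann_program D
      (Defeated z r s (compl x) :-
         [Pos (Is_proof_tag z);
          Pos (Team z);
          Pos (Common (sup_ t s));
          Pos (Common (supportive_rule_ t x vs))]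
         ++ map (fun v => Pos (Defeasibly z v)) vs)
| ann_defeated_indiv z r s x :
    ann_program D
      (Defeated z r s (compl x) :-
         [Pos (Is_proof_tag z);
          Pos (Indiv z);
          Pos (Common (sup_ r s))])
| ann_supported_free z x :
    ann_program D
      (Supported z (Ann free x) :-
         [Pos (Is_proof_tag z); Pos (Supported z (Ann z x))])
| ann_supported_fail z t x :
    ann_program D
      (Supported z (Fail t x) :-
         [Pos (Is_proof_tag z); Neg (Supported z (Ann t x))])
| ann_supported_definitely z t x :
    ann_program D
      (Supported z (Ann t x) :-
         [Pos (Is_proof_tag z); Pos (Common (definitely_ x))])
| ann_supported_rule z y r x ws :
    ann_program D
      (Supported z (Ann y x) :-
         [Pos (Is_proof_tag z);
          Pos (Is_proof_tag y);
          Pos (Common (supportive_rule_ r x ws))]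
         ++ map (fun w => Pos (Supported y w)) ws
         ++ [Neg (Beaten y r x)])
| ann_beaten z r x s ws :
    ann_program D
      (Beaten z r x :-
         [Pos (Is_proof_tag z);
          Pos (Common (rule_ s (compl x) ws))]
         ++ map (fun w => Pos (Defeasibly z w)) ws
         ++ [Pos (Common (sup_ s r))]).

(* Main.v *)
(** The two meta-programs are bisimilar as ground logic programs.  Call a body
    literal settled when the first few Fitting stages decide it.  Up to settled
    literals, the clauses of [M(alpha(D))] for [defeasibly_d(d q)],
    [overruled_d], [supported_d(d q)], ... match one by one those of [M_d(D)]
    for [defeasibly(q)], [overruled], [supported(q)], ...; the only mismatch is
    that [defeasibly_d(free q)] reaches [defeasibly_d(d q)], and, for the
    individual tags, [defeated_d(R,S,~X)] reaches [sup(R,S)], one stage late.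
    As the delay per stage is bounded by a constant, an atom decided at a finite
    stage of one program is decided at a finite stage of the other. *)
Require Import Defs.
From Stdlib Require Import List Relations Lia Classical.
Import ListNotations.
Set Implicit Arguments.
Unset Strict Implicit.

(** * Fitting stages *)

Section Stages.
Variables (At : Type) (P : program At).

(** Truth and falsity persist together: a literal is false exactly when the opposite one is true, so
    one induction over both signs suffices. It starts trivially, nothing being decided at stage
    0. *)
Lemma lit_true_step n l :
  lit_true (fitting_up P n) l -> lit_true (fitting_up P (S n)) l.
Proof.
  revert l; induction n as [|n IH]; [intros []; contradiction|].
  intros [a|a]; simpl.
  - intros (c & Hc & Ha & Hb); exists c; repeat split; auto.
    eapply Forall_impl; [exact IH|exact Hb].
  - intros H c Hc Ha; specialize (H c Hc Ha).
    eapply Exists_impl; [|exact H].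
    intros [b|b]; [exact (IH (Neg b))|exact (IH (Pos b))].
Qed.

Lemma lit_true_mono n m l :
  n <= m -> lit_true (fitting_up P n) l -> lit_true (fitting_up P m) l.
Proof. induction 1; auto using lit_true_step. Qed.

Lemma lit_false_mono n m l :
  n <= m -> lit_false (fitting_up P n) l -> lit_false (fitting_up P m) l.
Proof.
  destruct l as [a|a]; intros Hnm.
  - exact (@lit_true_mono n m (Neg a) Hnm).
  - exact (@lit_true_mono n m (Pos a) Hnm).
Qed.

Lemma body_false_mono n m b :
  n <= m -> Exists (lit_false (fitting_up P n)) b ->
  Exists (lit_false (fitting_up P m)) b.
Proof.
  intros Hnm; apply Exists_impl; intros l; exact (@lit_false_mono n m l Hnm).
Qed.

(** The clause that makes an atom true must, for the atom to be false, have a false body literal;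
    that literal is then both true and false one stage earlier. *)
Lemma stage_consistent n l :
  lit_true (fitting_up P n) l -> lit_false (fitting_up P n) l -> False.
Proof.
  revert l; induction n as [|n IH]; [intros []; contradiction|].
  assert (H : forall a, true_in (fitting_up P (S n)) a ->
                        false_in (fitting_up P (S n)) a -> False).
  { intros a (c & Hc & Ha & Ht) Hf; specialize (Hf c Hc Ha).
    apply Exists_exists in Hf; destruct Hf as (l & Hl & Hf).
    rewrite Forall_forall in Ht; exact (IH l (Ht l Hl) Hf). }
  intros [a|a] Ht Hf; [exact (H a Ht Hf)|exact (H a Hf Ht)].
Qed.

Lemma consistent n m l :
  lit_true (fitting_up P n) l -> lit_false (fitting_up P m) l -> False.
Proof.
  intros Ht Hf; apply (@stage_consistent (max n m) l).
  - eapply lit_true_mono; [|exact Ht]; lia.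
  - eapply lit_false_mono; [|exact Hf]; lia.
Qed.

Lemma body_consistent n m b :
  Forall (lit_true (fitting_up P n)) b ->
  Exists (lit_false (fitting_up P m)) b -> False.
Proof.
  intros Ht Hf; apply Exists_exists in Hf; destruct Hf as (l & Hl & Hf).
  rewrite Forall_forall in Ht; exact (consistent (Ht l Hl) Hf).
Qed.

End Stages.

(** * Bisimulation up to settled literals *)

(* [w] has, up to clauses and literals decided at stage [K], the value of [v]:
   it is derivable from [v], and each of its other live clauses is also a clause
   for [v]. *)
Record alias {At : Type} (P : program At) (K : nat) (v w : At) : Prop := Alias
  { alias_clause : exists b, P (w :- b) /\
      Forall (fun l => l = Pos v \/ lit_true (fitting_up P K) l) b;
    alias_only : forall b, P (w :- b) ->
      Exists (lit_false (fitting_up P K)) b \/ In (Pos v) b \/ P (v :- b) }.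

Definition resolves {At : Type} (P : program At) (K : nat) (v w : At) : Prop :=
  v = w \/ alias P K v w.

Section Resolves.
Variables (At : Type) (P : program At) (K : nat) (v w : At).
Hypothesis Hr : resolves P K v w.

(** Passing from an alias [w] to [v] costs no stage: a clause that makes [w] true is not dead, so it
    either contains [v], true one stage earlier, or is also a clause for [v]. *)
Lemma resolves_true n : true_in (fitting_up P n) w -> true_in (fitting_up P n) v.
Proof.
  destruct Hr as [->|[_ Hall]]; [auto|]; destruct n as [|n]; [contradiction|].
  intros ([h b] & Hc & Hh & Hb); simpl in Hh, Hb; subst h.
  destruct (Hall b Hc) as [Hd|[Hv|Hv]].
  - destruct (body_consistent Hb Hd).
  - rewrite Forall_forall in Hb.
    exact (@lit_true_step _ P n (Pos v) (Hb _ Hv)).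
  - exists (v :- b); auto.
Qed.

(** The defining clause of the alias has a false body literal, and consistency with stage [K] leaves
    only [v] for it. *)
Lemma resolves_false n :
  false_in (fitting_up P n) w -> false_in (fitting_up P n) v.
Proof.
  destruct Hr as [->|[(b & Hc & Hb) _]]; [auto|].
  destruct n as [|n]; [contradiction|].
  intros Hf; specialize (Hf _ Hc eq_refl); simpl in Hf.
  apply Exists_exists in Hf; destruct Hf as (l & Hl & Hf).
  rewrite Forall_forall in Hb; destruct (Hb l Hl) as [->|Ht].
  - exact (@lit_true_step _ P n (Neg v) Hf).
  - destruct (consistent Ht Hf).
Qed.

(** In this direction one stage is lost, since the defining clause of the alias has to fire;
    [K <= n] makes its settled literals available. *)
Lemma resolved_true n :
  K <= n -> true_in (fitting_up P n) v -> true_in (fitting_up P (S n)) w.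
Proof.
  intros Hn Hv; destruct Hr as [<-|[(b & Hc & Hb) _]].
  - exact (@lit_true_step _ P n (Pos v) Hv).
  - exists (w :- b); repeat split; auto.
    eapply Forall_impl; [|exact Hb]; intros l [->|Hl]; [exact Hv|].
    exact (lit_true_mono Hn Hl).
Qed.

Lemma resolved_false n :
  K <= n -> false_in (fitting_up P n) v -> false_in (fitting_up P (S n)) w.
Proof.
  intros Hn Hv; destruct Hr as [<-|[_ Hall]].
  - exact (@lit_true_step _ P n (Neg v) Hv).
  - intros [h b] Hc Hh; simpl in Hh |- *; subst h.
    destruct (Hall b Hc) as [Hd|[Hb|Hb]].
    + exact (body_false_mono Hn Hd).
    + apply Exists_exists; exists (Pos v); auto.
    + destruct n as [|n]; [contradiction|].
      specialize (Hv _ Hb eq_refl).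
      exact (body_false_mono (PeanoNat.Nat.le_succ_diag_r n) Hv).
Qed.

End Resolves.

(** * Clause-by-clause matching of two programs *)

Definition lit_rel {At At' : Type} (R : At -> At' -> Prop)
  (l : plit At) (l' : plit At') : Prop :=
  match l, l' with
  | Pos a, Pos b | Neg a, Neg b => R a b
  | _, _ => False
  end.

Definition flip {X Y : Type} (R : X -> Y -> Prop) : Y -> X -> Prop :=
  fun y x => R x y.

Section Bisimulation.
Variables (At At' : Type) (P : program At) (Q : program At')
  (R : At -> At' -> Prop) (K : nat).

(** Aliases are allowed on both sides, which keeps the notion symmetric under [flip]. *)
Definition related (a : At) (b : At') : Prop :=
  exists v u, resolves P K v a /\ resolves Q K u b /\ R v u.

(** Only literals already true at stage [K] may be skipped; a settled false literal kills its whole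
    clause, which is the other alternative in [covers]. *)
Inductive aligned : list (plit At) -> list (plit At') -> Prop :=
| aligned_nil : aligned [] []
| aligned_left l b b' :
    lit_true (fitting_up P K) l -> aligned b b' -> aligned (l :: b) b'
| aligned_right l' b b' :
    lit_true (fitting_up Q K) l' -> aligned b b' -> aligned b (l' :: b')
| aligned_cons l l' b b' :
    lit_rel related l l' -> aligned b b' -> aligned (l :: b) (l' :: b').

Lemma aligned_app b1 b1' b2 b2' :
  aligned b1 b1' -> aligned b2 b2' -> aligned (b1 ++ b2) (b1' ++ b2').
Proof.
  intros H H2; induction H; simpl;
    [exact H2|apply aligned_left|apply aligned_right|apply aligned_cons]; auto.
Qed.

Lemma related_incl a b : R a b -> related a b.
Proof. intros H; exists a, b; unfold resolves; auto. Qed.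

(** One half of a bisimulation; the other half is the same condition for [flip R]. *)
Definition covers : Prop := forall a b body, R a b -> P (a :- body) ->
  Exists (lit_false (fitting_up P K)) body
  \/ exists body', Q (b :- body') /\ aligned body body'.

Definition below (R' : At -> At' -> Prop) (n m : nat) : Prop :=
  forall a b, R' a b ->
    (true_in (fitting_up P n) a -> true_in (fitting_up Q m) b) /\
    (false_in (fitting_up P n) a -> false_in (fitting_up Q m) b).

(** Going from [a] to the atom it resolves to is free, and the extra stage pays for the way back
    from [u] to its alias [b]. *)
Lemma below_related n m : K <= m -> below R n m -> below related n (S m).
Proof.
  intros Hm H a b (v & u & Hv & Hu & Hvu); destruct (H _ _ Hvu) as [Ht Hf].
  split; intros Ha.
  - eapply resolved_true; eauto using resolves_true.
  - eapply resolved_false; eauto using resolves_false.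
Qed.

Lemma aligned_true n m b b' :
  aligned b b' -> K <= m -> below related n m ->
  Forall (lit_true (fitting_up P n)) b -> Forall (lit_true (fitting_up Q m)) b'.
Proof.
  intros Hal Hm HR;
    induction Hal as [|l b b' Hl _ IH|l' b b' Hl _ IH|l l' b b' Hll _ IH];
    intros Hb; auto.
  - exact (IH (Forall_inv_tail Hb)).
  - constructor; auto; exact (lit_true_mono Hm Hl).
  - constructor; [|exact (IH (Forall_inv_tail Hb))].
    apply Forall_inv in Hb; destruct l, l'; try contradiction;
      destruct (HR _ _ Hll) as [Ht Hf]; simpl; auto.
Qed.

(** A skipped literal of [b] is true at stage [K], so by consistency the false literal is among
    those that have a partner. *)
Lemma aligned_false n m b b' :
  aligned b b' -> below related n m ->
  Exists (lit_false (fitting_up P n)) b ->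
  Exists (lit_false (fitting_up Q m)) b'.
Proof.
  intros Hal HR;
    induction Hal as [|l b b' Hl _ IH|l' b b' Hl _ IH|l l' b b' Hll _ IH];
    intros Hb; auto.
  - inversion Hb.
  - inversion Hb as [? ? Hf|]; subst; [destruct (consistent Hl Hf)|auto].
  - inversion Hb as [? ? Hf|]; subst; auto.
    left; destruct l, l'; try contradiction;
      destruct (HR _ _ Hll) as [Ht Hf']; simpl; auto.
Qed.

End Bisimulation.

Lemma aligned_flip (At At' : Type) (P : program At) (Q : program At') R K b b' :
  aligned P Q R K b b' -> aligned Q P (flip R) K b' b.
Proof.
  induction 1 as [| | |l l' b b' H]; [constructor 1|constructor 3|constructor 2|
                                      constructor 4]; auto.
  destruct l, l'; simpl in *; try contradiction;
    destruct H as (v & u & Hv & Hu & HR); exists u, v; auto.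
Qed.

(** Truth needs one clause for [b], found by covering [P] by [Q]. Falsity needs every clause for [b]
    refuted, so each one is traced back to a clause for [a] by the converse covering. *)
Lemma covers_below (At At' : Type) (P : program At) (Q : program At') R K :
  covers P Q R K -> covers Q P (flip R) K -> forall n, exists m, below P Q R n m.
Proof.
  intros HPQ HQP n; induction n as [|n [m IH]].
  { exists 0; intros a b _; split; contradiction. }
  (* The maximum makes the settled literals available, and the successor pays for resolving aliases.
     The clause itself takes one further stage, hence the bound [S m']. *)
  set (m' := S (max m K)).
  assert (HT : below P Q (related P Q R K) n m').
  { apply below_related; [lia|]. intros a b Hab; destruct (IH a b Hab) as [Ht Hf].
    split; intros Ha.
    - apply (@lit_true_mono _ Q m _ (Pos b)); [lia|exact (Ht Ha)].
    - apply (@lit_true_mono _ Q m _ (Neg b)); [lia|exact (Hf Ha)]. }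
  exists (S m'); intros a b Hab; split.
  - intros ([h c] & Hc & Hh & Hb); simpl in Hh, Hb; subst h.
    destruct (HPQ a b c Hab Hc) as [Hd|(c' & Hc' & Hal)].
    + destruct (body_consistent Hb Hd).
    + exists (b :- c'); repeat split; auto.
      refine (aligned_true Hal (_ : K <= m') HT Hb); lia.
  - intros Hf [h c'] Hc' Hh; simpl in Hh |- *; subst h.
    destruct (HQP b a c' Hab Hc') as [Hd|(c & Hc & Hal)].
    + apply (@body_false_mono _ Q K m'); [lia|exact Hd].
    + exact (aligned_false (aligned_flip Hal) HT (Hf _ Hc eq_refl)).
Qed.

Lemma covers_kunen (At At' : Type) (P : program At) (Q : program At') R K a b :
  covers P Q R K -> covers Q P (flip R) K -> R a b ->
  (kunen P (Pos a) <-> kunen Q (Pos b)) /\ (kunen P (Neg a) <-> kunen Q (Neg b)).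
Proof.
  intros HPQ HQP Hab.
  assert (Hf := covers_below HPQ HQP); assert (Hb := covers_below HQP HPQ).
  split; split; intros [n Hn];
    [destruct (Hf n) as [m Hm]|destruct (Hb n) as [m Hm]|
     destruct (Hf n) as [m Hm]|destruct (Hb n) as [m Hm]];
    exists m; eapply Hm; eassumption.
Qed.

(** * Rules *)

(** The intended meaning of the atom [supportive_rule_ r x b], read off the theory instead of the
    program. *)
Definition supportive {A L B : Type} (bare : literal A -> B)
  (D : theory A L B) (r : L) (x : literal A) (b : list B) : Prop :=
  (exists b0, b = map bare b0 /\ In (Strict r x b0) (rules D))
  \/ In (Defeasible r x b) (rules D).

Definition applicable {A L B : Type} (bare : literal A -> B)
  (D : theory A L B) (r : L) (x : literal A) (b : list B) : Prop :=
  supportive bare D r x b \/ In (Defeater r x b) (rules D).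

(** * Settling of the rule atoms by stage 3 *)

Section Common.
Variables (A L B At : Type) (bare : literal A -> B) (D : theory A L B)
  (f : common_atom A L B -> At) (P : program At).
(** Stated for an arbitrary embedding [f] of the common atoms, so as to serve both meta-programs. *)
Hypothesis P_common : forall a body,
  P (f a :- body) <->
  exists b, common_program bare D (a :- b) /\ body = map (lift_plit f) b.

Lemma unit_clause_true n a b :
  common_program bare D (a :- [Pos b]) -> true_in (fitting_up P n) (f b) ->
  true_in (fitting_up P (S n)) (f a).
Proof.
  intros Hc Hb; exists (f a :- [Pos (f b)]); split; [|repeat constructor; exact Hb].
  apply P_common; eauto.
Qed.

Lemma empty_clause_true a :
  common_program bare D (a :- []) -> true_in (fitting_up P 1) (f a).
Proof.
  intros Hc; exists (f a :- []); split; [|repeat constructor].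
  apply P_common; eauto.
Qed.

(** The representation fact is true at stage 1, [supportive_rule_] at stage 2 and [rule_] at stage
    3; hence the bound 3 in the bisimulation below. *)
Lemma supportive_true2 r x b :
  supportive bare D r x b -> true_in (fitting_up P 2) (f (supportive_rule_ r x b)).
Proof.
  intros [(b0 & -> & H)|H].
  - exact (unit_clause_true (common_supportive_strict _ _ _ _ _)
             (empty_clause_true (rep_strict _ H))).
  - exact (unit_clause_true (common_supportive_defeasible _ _ _ _ _)
             (empty_clause_true (rep_defeasible _ H))).
Qed.

Lemma supportive_true r x b :
  supportive bare D r x b ->
  lit_true (fitting_up P 3) (Pos (f (supportive_rule_ r x b))).
Proof. intros H; apply lit_true_step; exact (supportive_true2 H). Qed.

Lemma applicable_true r x b :
  applicable bare D r x b ->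
  lit_true (fitting_up P 3) (Pos (f (rule_ r x b))).
Proof.
  intros [H|H].
  - exact (unit_clause_true (common_rule_supportive _ _ _ _ _) (supportive_true2 H)).
  - apply lit_true_step.
    exact (unit_clause_true (common_rule_defeater _ _ _ _ _)
             (empty_clause_true (rep_defeater _ H))).
Qed.

Lemma supportive_false2 r x b :
  ~ supportive bare D r x b ->
  lit_false (fitting_up P 2) (Pos (f (supportive_rule_ r x b))).
Proof.
  intros H [h c] Hc Hh; simpl in Hh |- *; subst h.
  apply P_common in Hc; destruct Hc as (b' & Hc & ->).
  (* The premise [strict_] or [defeasible_] has no clause other than its representation fact, so
     without that fact it is false at stage 1. *)
  inversion Hc; subst; left; intros [h c'] Hc' Hh; simpl in Hh; subst h;
    apply P_common in Hc'; destruct Hc' as (b'' & Hc' & ->);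
    inversion Hc'; subst; destruct H; unfold supportive; eauto.
Qed.

Lemma supportive_false r x b :
  ~ supportive bare D r x b ->
  lit_false (fitting_up P 3) (Pos (f (supportive_rule_ r x b))).
Proof. intros H; eapply lit_false_mono, supportive_false2, H; lia. Qed.

Lemma applicable_false r x b :
  ~ applicable bare D r x b ->
  lit_false (fitting_up P 3) (Pos (f (rule_ r x b))).
Proof.
  intros H [h c] Hc Hh; simpl in Hh |- *; subst h.
  apply P_common in Hc; destruct Hc as (b' & Hc & ->).
  inversion Hc; subst; left.
  - apply supportive_false2; unfold applicable in H; tauto.
  - apply (@lit_false_mono _ P 1 2 (Pos _)); [lia|].
    intros [h c'] Hc' Hh; simpl in Hh; subst h;
    apply P_common in Hc'; destruct Hc' as (b'' & Hc' & ->).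
    inversion Hc'; subst; destruct H; unfold applicable; auto.
Qed.

End Common.

(** * The correspondence *)

(** These are the two annotations that, under subscript [d], lead to the evaluation of [y] at tag
    [d]. *)
Definition annotates {A : Type} (d : ptag) (w : aexpr A) (y : literal A) : Prop :=
  w = Ann free y \/ w = Ann (Proof_tag d) y.

Section Annotated.
Variables (A L : Type) (D : defeasible_theory A L) (alpha : annotation L)
  (d : ptag).
Hypothesis Halpha : forall t : tag,
  annotation_used (annotate alpha D) t -> t = free \/ t = Proof_tag d.

Notation M := (ann_program (annotate alpha D)).
Notation Md := (orig_program d D).
Notation bare := (fun q : literal A => q).

(** * Annotated and original rule bodies *)

Lemma annotate_body_annotates f (b : list (literal A)) :
  (forall t q, In (Ann t q) (annotate_body f b) -> t = free \/ t = Proof_tag d) ->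
  Forall2 (annotates d) (annotate_body f b) b.
Proof.
  revert f; induction b as [|q b IH]; intros f H; simpl; constructor.
  - destruct (H (f 0) q) as [->| ->]; simpl; unfold annotates; auto.
  - apply IH; intros t q' Hq; apply (H t q'); simpl; auto.
Qed.

Lemma annotate_rule_annotates ru b :
  In ru (rules D) ->
  annotated_body (annotate_rule alpha ru) = annotate_body (alpha (label ru)) b ->
  Forall2 (annotates d) (annotate_body (alpha (label ru)) b) b.
Proof.
  intros Hru Hb; apply annotate_body_annotates; intros t q Hq; apply Halpha.
  exists (annotate_rule alpha ru), q; rewrite Hb; split; auto.
  exact (in_map _ _ _ Hru).
Qed.

Lemma Forall2_bare (b : list (literal A)) :
  Forall2 (annotates d) (map (Ann free) b) b.
Proof. induction b; simpl; constructor; unfold annotates; auto. Qed.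

Lemma supportive_annotated r x ws :
  supportive (Ann free) (annotate alpha D) r x ws ->
  exists ys, supportive bare D r x ys /\ Forall2 (annotates d) ws ys.
Proof.
  intros [(b & -> & H)|H]; apply in_map_iff in H;
    destruct H as ([r' p b'|r' p b'|r' p b'] & E & H); inversion E; subst.
  - exists b; split; [left; exists b; rewrite map_id; auto|apply Forall2_bare].
  - exists b'; split; [right; exact H|].
    exact (annotate_rule_annotates H eq_refl).
Qed.

Lemma supportive_original r x ys :
  supportive bare D r x ys ->
  exists ws, supportive (Ann free) (annotate alpha D) r x ws
    /\ Forall2 (annotates d) ws ys.
Proof.
  intros [(b & -> & H)|H]; assert (H' := in_map (annotate_rule alpha) _ _ H).
  - rewrite map_id; exists (map (Ann free) b); split; [left; eauto|].
    apply Forall2_bare.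
  - exists (annotate_body (alpha r) ys); split; [right; exact H'|].
    exact (annotate_rule_annotates H eq_refl).
Qed.

Lemma applicable_annotated r x ws :
  applicable (Ann free) (annotate alpha D) r x ws ->
  exists ys, applicable bare D r x ys /\ Forall2 (annotates d) ws ys.
Proof.
  intros [H|H].
  - destruct (supportive_annotated H) as (ys & H1 & H2); exists ys; split; auto.
    left; exact H1.
  - apply in_map_iff in H;
      destruct H as ([r' p b'|r' p b'|r' p b'] & E & H); inversion E; subst.
    exists b'; split; [right; exact H|].
    exact (annotate_rule_annotates H eq_refl).
Qed.

Lemma applicable_original r x ys :
  applicable bare D r x ys ->
  exists ws, applicable (Ann free) (annotate alpha D) r x ws
    /\ Forall2 (annotates d) ws ys.
Proof.
  intros [H|H].
  - destruct (supportive_original H) as (ws & H1 & H2); exists ws; split; auto.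
    left; exact H1.
  - exists (annotate_body (alpha r) ys); split.
    + right; exact (in_map (annotate_rule alpha) _ _ H).
    + exact (annotate_rule_annotates H eq_refl).
Qed.

(** Instance of [P_common]: only lifted common clauses have a [Common] head. *)
Lemma ann_common_iff a body :
  M (Common a :- body) <->
  exists b, common_program (Ann free) (annotate alpha D) (a :- b)
    /\ body = map (lift_plit Common) b.
Proof.
  split.
  - intros H; inversion H as [[h b] Hc| | | | | | | | | | | | | | | | | | | | | |].
    simpl in *; subst; eauto.
  - intros (b & Hb & ->); exact (ann_common Hb).
Qed.

Lemma orig_common_iff a body :
  Md (OCommon a :- body) <->
  exists b, common_program bare D (a :- b) /\ body = map (lift_plit OCommon) b.
Proof.
  split.
  - intros H; inversion H as [[h b] Hc|k c Hk Hc]; simpl in *; subst; eauto.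
    inversion Hc.
  - intros (b & Hb & ->); exact (orig_common d Hb).
Qed.

(** * Corresponding atoms of the two programs *)

(** Atoms that mention a body changed by the annotation are left out, being settled. The pairing for
    [Defeated] forgets [r], as team defeat does not depend on it. The side conditions exclude tags
    for which the original program has no clauses for the predicate while the annotated one does. *)
Inductive corresponds : ann_atom A L -> orig_atom A L -> Prop :=
| corr_fact x : corresponds (Common (fact_ x)) (OCommon (fact_ x))
| corr_strict r x b :
    corresponds (Common (strict_ r x b)) (OCommon (strict_ r x b))
| corr_sup r s : corresponds (Common (sup_ r s)) (OCommon (sup_ r s))
| corr_definitely x :
    corresponds (Common (definitely_ x)) (OCommon (definitely_ x))
| corr_defeasibly x :
    corresponds (Defeasibly (Proof_tag d) (Ann (Proof_tag d) x)) (ODefeasibly x)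
| corr_overruled r x :
    corresponds (Overruled (Proof_tag d) r x) (OOverruled r x)
| corr_defeated r s x :
    In cD (selected d) ->
    corresponds (Defeated (Proof_tag d) r s x) (ODefeated s x)
| corr_supported x :
    In cF (selected d) ->
    corresponds (Supported (Proof_tag d) (Ann (Proof_tag d) x)) (OSupported x)
| corr_beaten r x :
    In cF (selected d) ->
    corresponds (Beaten (Proof_tag d) r x) (OBeaten r x).

Lemma proof_tag_true :
  lit_true (fitting_up M 3) (Pos (Is_proof_tag (Proof_tag d))).
Proof.
  exists (Is_proof_tag (Proof_tag d) :- []).
  repeat split; [apply ann_proof_tag|constructor].
Qed.

Lemma proof_tag_free_false :
  lit_false (fitting_up M 3) (Pos (Is_proof_tag free)).
Proof. intros c Hc Hh; destruct Hc; discriminate. Qed.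

Lemma related_refl a b : corresponds a b -> related M Md corresponds 3 a b.
Proof. apply related_incl. Qed.

Lemma related_alias v a b :
  alias M 3 v a -> corresponds v b -> related M Md corresponds 3 a b.
Proof. intros Hv H; exists v, b; unfold resolves; auto. Qed.

(** Under annotation [free] there are three kinds of clause: the one that passes to annotation [d],
    the [definitely_] clause, shared with annotation [d], and the rule clauses, dead because [free]
    is no proof tag. *)
Lemma related_defeasibly w y :
  annotates d w y ->
  related M Md corresponds 3 (Defeasibly (Proof_tag d) w) (ODefeasibly y).
Proof.
  assert (Hp := proof_tag_true).
  intros [->| ->]; [|apply related_refl; constructor].
  eapply related_alias; [|apply corr_defeasibly]; split.
  - eexists; split; [apply ann_defeasibly_free|].
    constructor; [right; exact Hp|constructor; [left; reflexivity|constructor]].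
  - intros b H; inversion H; subst.
    + right; left; simpl; auto.
    + right; right; apply ann_defeasibly_definitely.
    + left; right; left; apply proof_tag_free_false.
Qed.

Lemma related_supported w y :
  In cF (selected d) -> annotates d w y ->
  related M Md corresponds 3 (Supported (Proof_tag d) w) (OSupported y).
Proof.
  assert (Hp := proof_tag_true).
  intros HF [->| ->]; [|apply related_refl; constructor; exact HF].
  eapply related_alias; [|apply corr_supported; exact HF]; split.
  - eexists; split; [apply ann_supported_free|].
    constructor; [right; exact Hp|constructor; [left; reflexivity|constructor]].
  - intros b H; inversion H; subst.
    + right; left; simpl; auto.
    + right; right; apply ann_supported_definitely.
    + left; right; left; apply proof_tag_free_false.
Qed.

(** Without clause D the tag is an individual one, for which [Defeated] merely passes on
    [sup_ r s]. *)
Lemma related_indiv r s x :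
  ~ In cD (selected d) ->
  related M Md corresponds 3 (Defeated (Proof_tag d) r s (compl x))
    (OCommon (sup_ r s)).
Proof.
  assert (Hp := proof_tag_true); intros Hd.
  eapply related_alias; [|apply corr_sup]; split.
  - eexists; split; [apply ann_defeated_indiv|].
    constructor; [right; exact Hp|].
    constructor; [right|constructor; [left; reflexivity|constructor]].
    exists (Indiv (Proof_tag d) :- []); repeat split; [|constructor].
    destruct d; simpl in Hd; try tauto; constructor.
  - intros b H; inversion H; subst.
    (* The team clause is dead: there is no [Team] fact for an individual tag. *)
    + left; right; left; intros c Hc Hh.
      destruct Hc; try discriminate; injection Hh as <-; simpl in Hd; tauto.
    + right; left; simpl; auto.
Qed.

(** * Alignment of matching clause bodies *)

Lemma aligned_defeasibly ws ys :
  Forall2 (annotates d) ws ys ->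
  aligned M Md corresponds 3
    (map (fun w => Pos (Defeasibly (Proof_tag d) w)) ws)
    (map (fun y => Pos (ODefeasibly y)) ys).
Proof.
  induction 1; simpl; [constructor 1|constructor 4; auto].
  apply related_defeasibly; auto.
Qed.

Lemma aligned_supported ws ys :
  In cF (selected d) -> Forall2 (annotates d) ws ys ->
  aligned M Md corresponds 3
    (map (fun w => Pos (Supported (Proof_tag d) w)) ws)
    (map (fun y => Pos (OSupported y)) ys).
Proof.
  intros HF; induction 1; simpl; [constructor 1|constructor 4; auto].
  apply related_supported; auto.
Qed.

Lemma empty_ann_clause_true a :
  M (a :- []) -> lit_true (fitting_up M 3) (Pos a).
Proof. intros H; exists (a :- []); repeat split; [exact H|constructor]. Qed.

(** The two rule literals carry different bodies and are not paired; each is skipped as a settled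
    truth of its own program. *)
Lemma aligned_support r x ws ys b b' :
  supportive (Ann free) (annotate alpha D) r x ws -> supportive bare D r x ys ->
  aligned M Md corresponds 3 b b' ->
  aligned M Md corresponds 3
    (Pos (Common (supportive_rule_ r x ws)) :: b)
    (Pos (OCommon (supportive_rule_ r x ys)) :: b').
Proof.
  intros Hw Hy Hb; apply aligned_left; [exact (supportive_true ann_common_iff Hw)|].
  apply aligned_right; [exact (supportive_true orig_common_iff Hy)|exact Hb].
Qed.

Lemma aligned_applicable r x ws ys b b' :
  applicable (Ann free) (annotate alpha D) r x ws -> applicable bare D r x ys ->
  aligned M Md corresponds 3 b b' ->
  aligned M Md corresponds 3
    (Pos (Common (rule_ r x ws)) :: b) (Pos (OCommon (rule_ r x ys)) :: b').
Proof.
  intros Hw Hy Hb; apply aligned_left; [exact (applicable_true ann_common_iff Hw)|].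
  apply aligned_right; [exact (applicable_true orig_common_iff Hy)|exact Hb].
Qed.

Lemma aligned_last b b' l l' :
  aligned M Md corresponds 3 b b' -> lit_rel (related M Md corresponds 3) l l' ->
  aligned M Md corresponds 3 (b ++ [l]) (b' ++ [l']).
Proof.
  intros Hb Hl; apply aligned_app; [exact Hb|].
  apply aligned_cons; [exact Hl|apply aligned_nil].
Qed.

Lemma aligned_B r x ws ys :
  supportive (Ann free) (annotate alpha D) r x ws -> supportive bare D r x ys ->
  Forall2 (annotates d) ws ys ->
  aligned M Md corresponds 3
    ([Pos (Is_proof_tag (Proof_tag d)); Pos (Is_proof_tag (Proof_tag d));
      Neg (Common (definitely_ (compl x))); Pos (Common (supportive_rule_ r x ws))]
     ++ map (fun w => Pos (Defeasibly (Proof_tag d) w)) ws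
     ++ [Neg (Overruled (Proof_tag d) r x)])
    ([Neg (OCommon (definitely_ (compl x)));
      Pos (OCommon (supportive_rule_ r x ys))]
     ++ map (fun y => Pos (ODefeasibly y)) ys ++ [Neg (OOverruled r x)]).
Proof.
  intros Hw Hy Hwy.
  apply aligned_left; [exact proof_tag_true|].
  apply aligned_left; [exact proof_tag_true|].
  apply aligned_cons; [apply related_refl; constructor|].
  apply aligned_support; auto.
  apply aligned_last; [apply aligned_defeasibly, Hwy|apply related_refl; constructor].
Qed.

Lemma aligned_D r x s t ws ys :
  In cD (selected d) ->
  supportive (Ann free) (annotate alpha D) t x ws -> supportive bare D t x ys ->
  Forall2 (annotates d) ws ys ->
  aligned M Md corresponds 3
    ([Pos (Is_proof_tag (Proof_tag d)); Pos (Team (Proof_tag d));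
      Pos (Common (sup_ r s)); Pos (Common (supportive_rule_ t x ws))]
     ++ map (fun w => Pos (Defeasibly (Proof_tag d) w)) ws)
    ([Pos (OCommon (sup_ r s)); Pos (OCommon (supportive_rule_ t x ys))]
     ++ map (fun y => Pos (ODefeasibly y)) ys).
Proof.
  intros Hd Hw Hy Hwy.
  apply aligned_left; [exact proof_tag_true|].
  apply aligned_left.
  { apply empty_ann_clause_true; revert Hd; clear; destruct d; simpl;
      intuition (try discriminate); constructor. }
  apply aligned_cons; [apply related_refl; constructor|].
  apply aligned_support; auto using aligned_defeasibly.
Qed.

Lemma aligned_F r x ws ys :
  In cF (selected d) ->
  supportive (Ann free) (annotate alpha D) r x ws -> supportive bare D r x ys ->
  Forall2 (annotates d) ws ys ->
  aligned M Md corresponds 3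
    ([Pos (Is_proof_tag (Proof_tag d)); Pos (Is_proof_tag (Proof_tag d));
      Pos (Common (supportive_rule_ r x ws))]
     ++ map (fun w => Pos (Supported (Proof_tag d) w)) ws
     ++ [Neg (Beaten (Proof_tag d) r x)])
    ([Pos (OCommon (supportive_rule_ r x ys))]
     ++ map (fun y => Pos (OSupported y)) ys ++ [Neg (OBeaten r x)]).
Proof.
  intros HF Hw Hy Hwy.
  apply aligned_left; [exact proof_tag_true|].
  apply aligned_left; [exact proof_tag_true|].
  apply aligned_support; auto.
  apply aligned_last; [apply aligned_supported; auto|].
  apply related_refl; constructor; exact HF.
Qed.

Lemma aligned_G r x s ws ys :
  applicable (Ann free) (annotate alpha D) s x ws -> applicable bare D s x ys ->
  Forall2 (annotates d) ws ys ->
  aligned M Md corresponds 3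
    ([Pos (Is_proof_tag (Proof_tag d)); Pos (Common (rule_ s x ws))]
     ++ map (fun w => Pos (Defeasibly (Proof_tag d) w)) ws
     ++ [Pos (Common (sup_ s r))])
    ([Pos (OCommon (rule_ s x ys))]
     ++ map (fun y => Pos (ODefeasibly y)) ys ++ [Pos (OCommon (sup_ s r))]).
Proof.
  intros Hw Hy Hwy.
  apply aligned_left; [exact proof_tag_true|].
  apply aligned_applicable; auto.
  apply aligned_last; [apply aligned_defeasibly, Hwy|apply related_refl; constructor].
Qed.

(** Serves clauses C, H, I and J at once: [amb] is the ambiguity mode, [b] the premises of the
    attacking rule, and [l] the test of whether the attack is defeated. *)
Lemma aligned_overruled amb s x ws ys b b' l l' :
  M (amb :- []) ->
  applicable (Ann free) (annotate alpha D) s x ws -> applicable bare D s x ys ->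
  aligned M Md corresponds 3 b b' -> lit_rel (related M Md corresponds 3) l l' ->
  aligned M Md corresponds 3
    ([Pos (Is_proof_tag (Proof_tag d)); Pos amb; Pos (Common (rule_ s x ws))]
     ++ b ++ [l])
    ([Pos (OCommon (rule_ s x ys))] ++ b' ++ [l']).
Proof.
  intros Ha Hw Hy Hb Hl.
  apply aligned_left; [exact proof_tag_true|].
  apply aligned_left; [apply empty_ann_clause_true, Ha|].
  apply aligned_applicable; auto using aligned_last.
Qed.

Definition common_rel
  (l : plit (common_atom A L (aexpr A))) (l' : plit (common_atom A L (literal A)))
  : Prop :=
  lit_rel (fun a a' => corresponds (Common a) (OCommon a')) l l'.

Lemma aligned_common (b : list (plit (common_atom A L (aexpr A))))
  (b' : list (plit (common_atom A L (literal A)))) :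
  Forall2 common_rel b b' ->
  aligned M Md corresponds 3
    (map (lift_plit Common) b) (map (lift_plit OCommon) b').
Proof.
  induction 1 as [|[a|a] [a'|a'] b b' H]; simpl in *; try contradiction;
    [apply aligned_nil| |]; apply aligned_cons; auto; apply related_refl, H.
Qed.

Lemma strict_annotate r x b :
  In (Strict r x b) (rules (annotate alpha D)) <-> In (Strict r x b) (rules D).
Proof.
  split; intros H.
  - apply in_map_iff in H; destruct H as ([] & E & H); inversion E; subst; exact H.
  - exact (in_map (annotate_rule alpha) _ _ H).
Qed.

Lemma corresponds_definitely_body r x (ys : list (literal A)) :
  Forall2 common_rel
    (Pos (strict_ r x ys) :: map (fun y => Pos (definitely_ y)) ys)
    (Pos (strict_ r x ys) :: map (fun y => Pos (definitely_ y)) ys).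
Proof.
  constructor; [simpl; constructor|].
  induction ys; simpl; constructor; auto; simpl; constructor.
Qed.

(** The common atoms that correspond depend only on facts, strict rules and superiority, which
    annotation leaves unchanged, so their clauses match literal by literal. *)
Lemma common_clauses a a' :
  corresponds (Common a) (OCommon a') ->
  (forall b, common_program (Ann free) (annotate alpha D) (a :- b) ->
    exists b', common_program bare D (a' :- b') /\ Forall2 common_rel b b') /\
  (forall b', common_program bare D (a' :- b') ->
    exists b, common_program (Ann free) (annotate alpha D) (a :- b) /\
      Forall2 common_rel b b').
Proof.
  assert (Hfact : forall x, Forall2 common_rel [Pos (fact_ x)] [Pos (fact_ x)]).
  { repeat constructor. }
  intros Hc; inversion Hc; subst; split; intros c Hb; inversion Hb; subst.
  3,4: exists []; split; auto; constructor; apply strict_annotate; assumption.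
  all: eauto using @common_program, corresponds_definitely_body.
Qed.

(** * The two covering conditions *)

Lemma dead {At : Type} (Q : program At) n l b :
  In l b -> lit_false (fitting_up Q n) l -> Exists (lit_false (fitting_up Q n)) b.
Proof. intros; apply Exists_exists; eauto. Qed.

Lemma selected_clause k h b : In k (selected d) -> orig_clause k (h :- b) -> Md (h :- b).
Proof. apply orig_selected. Qed.

(** The annotated program has clauses for all four tags. Those with no counterpart in the program
    for [d] are dead, either because they name a rule outside the theory or because a mode literal
    such as [Team] or [Ambiguity_blocking] fails for [d]. *)
Lemma covers_annotated : covers M Md corresponds 3.
Proof.
  intros a b body Hab HP.
  assert (Hcommon : forall a0 b0, a = Common a0 -> b = OCommon b0 ->
    exists body', Md (b :- body') /\ aligned M Md corresponds 3 body body').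
  { intros a0 b0 -> ->; apply ann_common_iff in HP; destruct HP as (c & Hc & ->).
    destruct (proj1 (common_clauses Hab) c Hc) as (c' & Hc' & Hcc').
    exists (map (lift_plit OCommon) c'); split; [apply orig_common_iff; eauto|].
    apply aligned_common, Hcc'. }
  destruct Hab as [x|r x b'|r s|x|x|r x|r s x Hd|x HF|r x HF];
    [right; eapply Hcommon; reflexivity..| | | | |]; clear Hcommon;
    inversion HP; subst.
  - right; eexists; split.
    { eapply selected_clause; [|apply orig_A]; destruct d; simpl; tauto. }
    apply aligned_left; [exact proof_tag_true|].
    apply aligned_cons; [apply related_refl; constructor|apply aligned_nil].
  (* The clause instance ranges over all [r] and [ws]. Whether they form a rule of the theory is not
     decidable over arbitrary types, hence the classical split. *)
  - destruct (classic (supportive (Ann free) (annotate alpha D) r x ws))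
      as [Hs|Hs].
    2: { left; eapply dead; [|exact (supportive_false ann_common_iff Hs)].
         simpl; tauto. }
    destruct (supportive_annotated Hs) as (ys & Hy & Hws).
    right; eexists; split; [|apply aligned_B; eassumption].
    eapply selected_clause; [|apply orig_B]; destruct d; simpl; tauto.
  - destruct (classic (applicable (Ann free) (annotate alpha D) s (compl x) us))
      as [Hs|Hs].
    2: { left; eapply dead; [|exact (applicable_false ann_common_iff Hs)].
         simpl; tauto. }
    destruct (applicable_annotated Hs) as (ys & Hy & Hws).
    (* The blocking clause becomes C for [partial] and I for [partial_star]; for the propagating
       tags its mode literal is false. *)
    destruct (classic (In cC (selected d) \/ In cI (selected d))) as [Hd|Hd].
    + assert (HM : M (Ambiguity_blocking (Proof_tag d) :- [])).
      { revert Hd; clear; destruct d; simpl; intuition (try discriminate); constructor. }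
      destruct Hd as [Hd|Hd]; right; eexists; (split;
        [eapply selected_clause; [exact Hd|constructor]
        |apply aligned_overruled; eauto using aligned_defeasibly]).
      * apply related_refl; constructor.
        revert Hd; clear; destruct d; simpl; intuition discriminate.
      * apply related_indiv.
        revert Hd; clear; destruct d; simpl; intuition discriminate.
    + left; eapply dead with (l := Pos (Ambiguity_blocking (Proof_tag d))); [simpl; tauto|].
      intros c Hc Hh; destruct Hc; try discriminate; injection Hh as <-; simpl in Hd; tauto.
  - destruct (classic (applicable (Ann free) (annotate alpha D) s (compl x) us))
      as [Hs|Hs].
    2: { left; eapply dead; [|exact (applicable_false ann_common_iff Hs)].
         simpl; tauto. }
    destruct (applicable_annotated Hs) as (ys & Hy & Hws).
    (* Dually, the propagating clause becomes H for [delta] and J for [delta_star]. *)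
    destruct (classic (In cH (selected d) \/ In cJ (selected d))) as [Hd|Hd].
    + assert (HM : M (Ambiguity_propagating (Proof_tag d) :- []) /\ In cF (selected d)).
      { revert Hd; clear; destruct d; simpl; intuition (try discriminate); constructor. }
      destruct HM as [HM HF].
      destruct Hd as [Hd|Hd]; right; eexists; (split;
        [eapply selected_clause; [exact Hd|constructor]
        |apply aligned_overruled; eauto using aligned_supported]).
      * apply related_refl; constructor.
        revert Hd; clear; destruct d; simpl; intuition discriminate.
      * apply related_indiv.
        revert Hd; clear; destruct d; simpl; intuition discriminate.
    + left; eapply dead with (l := Pos (Ambiguity_propagating (Proof_tag d))); [simpl; tauto|].
      intros c Hc Hh; destruct Hc; try discriminate; injection Hh as <-; simpl in Hd; tauto.
  - destruct (classic (supportive (Ann free) (annotate alpha D) t x0 vs))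
      as [Hs|Hs].
    2: { left; eapply dead; [|exact (supportive_false ann_common_iff Hs)].
         simpl; tauto. }
    destruct (supportive_annotated Hs) as (ys & Hy & Hws).
    right; eexists; split; [|apply aligned_D; eassumption].
    eapply selected_clause; [exact Hd|apply orig_D].
  (* The individual clause for [Defeated] is dead, as clause D is selected for team tags only. *)
  - left; eapply dead with (l := Pos (Indiv (Proof_tag d))); [simpl; tauto|].
    intros c Hc Hh; destruct Hc; try discriminate; injection Hh as <-; simpl in Hd;
      intuition discriminate.
  - right; eexists; split.
    { eapply selected_clause; [|apply orig_E]; destruct d; simpl in *; intuition discriminate. }
    apply aligned_left; [exact proof_tag_true|].
    apply aligned_cons; [apply related_refl; constructor|apply aligned_nil].
  - destruct (classic (supportive (Ann free) (annotate alpha D) r x ws))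
      as [Hs|Hs].
    2: { left; eapply dead; [|exact (supportive_false ann_common_iff Hs)].
         simpl; tauto. }
    destruct (supportive_annotated Hs) as (ys & Hy & Hws).
    right; eexists; split; [|apply aligned_F; eassumption].
    eapply selected_clause; [exact HF|apply orig_F].
  - destruct (classic (applicable (Ann free) (annotate alpha D) s (compl x) ws))
      as [Hs|Hs].
    2: { left; eapply dead; [|exact (applicable_false ann_common_iff Hs)].
         simpl; tauto. }
    destruct (applicable_annotated Hs) as (ys & Hy & Hws).
    right; eexists; split; [|apply aligned_G; eassumption].
    eapply selected_clause; [|apply orig_G]; destruct d; simpl in *; intuition discriminate.
Qed.

(** Every selected clause has a counterpart in the annotated program with its mode literals true, so
    only instances that name no rule of the theory are dead. *)
Lemma covers_original : covers Md M (flip corresponds) 3.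
Proof.
  intros b a body Hab HP.
  (* Turning the alignment around lets the same alignment lemmas serve for both coverings. *)
  enough (H : Exists (lit_false (fitting_up Md 3)) body
    \/ exists body', M (a :- body') /\ aligned M Md corresponds 3 body' body).
  { destruct H as [H|(body' & H & Hal)]; [auto|right].
    exists body'; split; [exact H|exact (aligned_flip Hal)]. }
  assert (Hcommon : forall a0 b0, a = Common a0 -> b = OCommon b0 ->
    exists body', M (a :- body') /\ aligned M Md corresponds 3 body' body).
  { intros a0 b0 -> ->; apply orig_common_iff in HP; destruct HP as (c & Hc & ->).
    destruct (proj2 (common_clauses Hab) c Hc) as (c' & Hc' & Hcc').
    exists (map (lift_plit Common) c'); split; [apply ann_common_iff; eauto|].
    apply aligned_common, Hcc'. }
  destruct Hab as [x|r x b'|r s|x|x|r x|r s x Hd|x HF|r x HF];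
    [right; eapply Hcommon; reflexivity..| | | | |]; clear Hcommon;
    inversion HP as [|k c Hk Hc]; subst; inversion Hc; subst.
  - right; eexists; split; [apply ann_defeasibly_definitely|].
    apply aligned_left; [exact proof_tag_true|].
    apply aligned_cons; [apply related_refl; constructor|apply aligned_nil].
  - destruct (classic (supportive bare D r x ys)) as [Hs|Hs].
    2: { left; eapply dead; [|exact (supportive_false orig_common_iff Hs)].
         simpl; tauto. }
    destruct (supportive_original Hs) as (ws & Hw & Hws).
    right; eexists; split; [apply ann_defeasibly_rule|apply aligned_B; eassumption].
  (* From here on come the four clauses for [OOverruled], in the order C, H, I, J. *)
  - destruct (classic (applicable bare D s (compl x) us)) as [Hs|Hs].
    2: { left; eapply dead; [|exact (applicable_false orig_common_iff Hs)].
         simpl; tauto. }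
    destruct (applicable_original Hs) as (ws & Hw & Hws).
    right; eexists; split; [apply ann_overruled_blocking|].
    apply aligned_overruled; eauto using aligned_defeasibly.
    + revert Hk; clear; destruct d; simpl; intuition (try discriminate); constructor.
    + apply related_refl; constructor.
      revert Hk; clear; destruct d; simpl; intuition discriminate.
  - destruct (classic (applicable bare D s (compl x) us)) as [Hs|Hs].
    2: { left; eapply dead; [|exact (applicable_false orig_common_iff Hs)].
         simpl; tauto. }
    destruct (applicable_original Hs) as (ws & Hw & Hws).
    right; eexists; split; [apply ann_overruled_propagating|].
    apply aligned_overruled; eauto.
    + revert Hk; clear; destruct d; simpl; intuition (try discriminate); constructor.
    + apply aligned_supported; [|exact Hws].
      revert Hk; clear; destruct d; simpl; intuition discriminate.
    + apply related_refl; constructor.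
      revert Hk; clear; destruct d; simpl; intuition discriminate.
  - destruct (classic (applicable bare D s (compl x) us)) as [Hs|Hs].
    2: { left; eapply dead; [|exact (applicable_false orig_common_iff Hs)].
         simpl; tauto. }
    destruct (applicable_original Hs) as (ws & Hw & Hws).
    right; eexists; split; [apply ann_overruled_blocking|].
    apply aligned_overruled; eauto using aligned_defeasibly.
    + revert Hk; clear; destruct d; simpl; intuition (try discriminate); constructor.
    + apply related_indiv.
      revert Hk; clear; destruct d; simpl; intuition discriminate.
  - destruct (classic (applicable bare D s (compl x) us)) as [Hs|Hs].
    2: { left; eapply dead; [|exact (applicable_false orig_common_iff Hs)].
         simpl; tauto. }
    destruct (applicable_original Hs) as (ws & Hw & Hws).
    right; eexists; split; [apply ann_overruled_propagating|].
    apply aligned_overruled; eauto.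
    + revert Hk; clear; destruct d; simpl; intuition (try discriminate); constructor.
    + apply aligned_supported; [|exact Hws].
      revert Hk; clear; destruct d; simpl; intuition discriminate.
    + apply related_indiv.
      revert Hk; clear; destruct d; simpl; intuition discriminate.
  - destruct (classic (supportive bare D t x0 vs)) as [Hs|Hs].
    2: { left; eapply dead; [|exact (supportive_false orig_common_iff Hs)].
         simpl; tauto. }
    destruct (supportive_original Hs) as (ws & Hw & Hws).
    right; eexists; split; [apply ann_defeated_team|apply aligned_D; eassumption].
  - right; eexists; split; [apply ann_supported_definitely|].
    apply aligned_left; [exact proof_tag_true|].
    apply aligned_cons; [apply related_refl; constructor|apply aligned_nil].
  - destruct (classic (supportive bare D r x ys)) as [Hs|Hs].
    2: { left; eapply dead; [|exact (supportive_false orig_common_iff Hs)].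
         simpl; tauto. }
    destruct (supportive_original Hs) as (ws & Hw & Hws).
    right; eexists; split; [apply ann_supported_rule|apply aligned_F; eassumption].
  - destruct (classic (applicable bare D s (compl x) ws)) as [Hs|Hs].
    2: { left; eapply dead; [|exact (applicable_false orig_common_iff Hs)].
         simpl; tauto. }
    destruct (applicable_original Hs) as (vs & Hw & Hws).
    right; eexists; split; [apply ann_beaten|apply aligned_G; eassumption].
Qed.

End Annotated.

Theorem theorem1 (A L : Type) (D : defeasible_theory A L)
  (alpha : annotation L) (d : ptag)
  (Halpha : forall t : tag,
      annotation_used (annotate alpha D) t -> t = free \/ t = Proof_tag d) :
  (forall q : literal A,
    (kunen (ann_program (annotate alpha D))
       (Pos (Defeasibly (Proof_tag d) (Ann (Proof_tag d) q)))
     <-> kunen (orig_program d D) (Pos (ODefeasibly q)))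
    /\
    (kunen (ann_program (annotate alpha D))
       (Neg (Defeasibly (Proof_tag d) (Ann (Proof_tag d) q)))
     <-> kunen (orig_program d D) (Neg (ODefeasibly q))))
  /\
  (d = delta_star \/ d = delta ->
   forall q : literal A,
    (kunen (ann_program (annotate alpha D))
       (Pos (Supported (Proof_tag d) (Ann (Proof_tag d) q)))
     <-> kunen (orig_program d D) (Pos (OSupported q)))
    /\
    (kunen (ann_program (annotate alpha D))
       (Neg (Supported (Proof_tag d) (Ann (Proof_tag d) q)))
     <-> kunen (orig_program d D) (Neg (OSupported q)))).
Proof.
  assert (HM := covers_annotated Halpha); assert (HMd := covers_original Halpha).
  split.
  - intros q; exact (covers_kunen HM HMd (corr_defeasibly L d q)).
  - intros Hd q; refine (covers_kunen HM HMd (corr_supported L q _)).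
    destruct Hd as [->| ->]; simpl; tauto.
Qed.
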